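(* Assume the Continuum Hypothesis. Then the C*-algebra $C([0,1)^* )$ has $2^{\aleph_1}$ automorphisms and the space $[0,1)^*$ has $2^{\aleph_1}$ autohomeomorphisms. In particular, $[0,1)^*$ has nontrivial autohomeomorphisms.
   Context: $\beta X$ denotes the Stone--Čech compactification of $X$ and $X^*=\beta X\setminus X$ its remainder; $C(K)$ is the C*-algebra of continuous complex-valued functions on the compact Hausdorff space $K$. For locally compact Polish (separable, completely metrizable) spaces $X,Y$, a continuous map $\Phi\colon X^*\to Y^*$ is trivial if there are a compact $K\subseteq X$ and a continuous map $f\colon X\setminus K\to Y$ such that $\Phi=\beta f\restriction X^*$, where $\beta f$ is the unique continuous extension of $f$ (to $\beta X\setminus K$) with values in $\beta Y$. It is nontrivial if it is not trivial. *)

(* Defs.v *)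
From HB Require Import structures.
From mathcomp Require Import all_boot all_order all_algebra.
From mathcomp Require Import complex wochoice.
From mathcomp Require Import all_classical all_reals all_analysis.

Set Implicit Arguments.
Unset Strict Implicit.
Unset Printing Implicit Defensive.

Import Order.TTheory GRing.Theory Num.Theory.
Import numFieldNormedType.Exports.

Local Open Scope classical_set_scope.
Local Open Scope card_scope.
Local Open Scope ring_scope.

Section Cardinals.

(* [le] has order type omega_1. *)
Definition is_omega1 (W : Type) (le : rel W) : Prop :=
  [/\ well_order le,
      ~ countable [set: W]
    & forall x, countable [set y | le y x]].

Definition card_aleph1 (T : Type) (A : set T) : Prop :=
  exists (W : Type) (le : rel W), is_omega1 le /\ A #= [set: W].

Definition card_exp2_aleph1 (T : Type) (A : set T) : Prop :=
  exists (W : Type) (le : rel W), is_omega1 le /\ A #= [set: set W].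

Definition continuum_hypothesis : Prop := card_aleph1 [set: set nat].

End Cardinals.

Definition homeomorphism (X Y : topologicalType) (h : X -> Y) : Prop :=
  exists g : Y -> X, [/\ continuous h, continuous g, cancel h g & cancel g h].

(* For a Tychonoff space [X] (in particular a locally compact Polish one),
   [beta R X] is the Stone-Cech compactification: the closure of the canonical
   image of [X] in the cube of all continuous maps from [X] to [0, 1]. *)
Section StoneCech.
Variables (R : realType) (X : topologicalType).

Definition unit_map : Type :=
  {f : X -> R^o | continuous f /\ forall x, 0 <= f x <= 1}.
HB.instance Definition _ := gen_eqMixin unit_map.
HB.instance Definition _ := gen_choiceMixin unit_map.

Definition beta_eval (x : X) : {ptws unit_map -> R^o} :=
  fun f => sval f x.

Definition beta : Type := closure (range beta_eval).
HB.instance Definition _ := Topological.on beta.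

Definition beta_in (x : X) : beta :=
  SigSub (mem_set (subset_closure (imageT beta_eval x))).

Definition remainder : Type := ~` range beta_in.
HB.instance Definition _ := Topological.on remainder.

End StoneCech.

(* [F] is the extension of [f] to beta X \ K with values in beta Y; it is
   unique, since X \ K is dense in beta X \ K and beta Y is Hausdorff. *)
Definition trivial_map (R : realType) (X Y : topologicalType)
    (Phi : remainder R X -> remainder R Y) : Prop :=
  exists (K : set X) (f : ~` K -> Y)
         (F : ~` (@beta_in R X @` K) -> beta R Y),
    [/\ compact K,
        continuous f,
        continuous F,
        forall p x, val p = beta_in R (val x) -> F p = beta_in R (f x)
      & forall p (q : remainder R X), val p = val q -> F p = val (Phi q)].

(* C(K) is the subalgebra of continuous functions of the pointwise algebra
   of all functions from K to the complex numbers. *)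
Section ContinuousFunctions.
Variables (R : realType) (K : topologicalType).

Local Notation C := (complex R).

Definition continuous_pred : {pred K -> C^o} := fun f => `[< continuous f >].

Lemma continuous_subring_closed : subring_closed continuous_pred.
Proof.
split; first by apply/asboolP => x; exact: cvg_cst.
- move=> f g /asboolP cf /asboolP cg; apply/asboolP => x.
  exact: (@cvgB C C^o K (nbhs x) _ f g _ _ (cf x) (cg x)).
- move=> f g /asboolP cf /asboolP cg; apply/asboolP => x.
  exact: (@cvgM C K (nbhs x) _ f g _ _ (cf x) (cg x)).
Qed.

Lemma continuous_scaler_closed : scaler_closed continuous_pred.
Proof.
move=> a f /asboolP cf; apply/asboolP => x.
by apply: cvgZl_tmp; exact: cf.
Qed.

HB.instance Definition _ :=
  GRing.isSubringClosed.Build _ continuous_pred continuous_subring_closed.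
HB.instance Definition _ :=
  GRing.isScaleClosed.Build _ _ continuous_pred continuous_scaler_closed.

Definition cfun : Type := {f : K -> C^o | f \in continuous_pred}.

HB.instance Definition _ := SubChoice.on cfun.
HB.instance Definition _ :=
  GRing.SubChoice_isSubComPzRing.Build _ _ cfun
    (subringClosedP continuous_pred).
HB.instance Definition _ := [SubZmodule_isSubLmodule of cfun by <:].

Lemma conj_continuous (f : cfun) :
  (fun x => Num.conj (val f x) : C^o) \in continuous_pred.
Proof.
apply/asboolP => x; have /asboolP cf := valP f.
apply/cvgrPdist_lt => e e0.
move/cvgrPdist_lt: (cf x) => /(_ e e0); apply: filterS => y.
by rewrite -raddfB norm_conjC.
Qed.

Definition cfun_star (f : cfun) : cfun := SigSub (conj_continuous f).

Definition cstar_automorphism (phi : cfun -> cfun) : Prop :=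
  [/\ bijective phi,
      linear phi,
      {morph phi : f g / f * g},
      phi 1 = 1
    & {morph phi : f / cfun_star f}].

End ContinuousFunctions.

Definition half_open_interval (R : realType) : Type :=
  `[0, 1[%classic : set R^o.
HB.instance Definition _ (R : realType) :=
  Topological.on (half_open_interval R).

(* Main.v *)
(* Let K be the remainder of [0,1).  A homeomorphism of K is produced as a limit of
   trivial ones.  Identify [0,1) with [0,oo) and let a sequence t : nat -> R act by
   flowing for time t n on each interval [n, n+1], the flow fixing the integers.  If
   a net (s_a) of sequences indexed by omega_1 is Cauchy, in the sense that for every
   positive sequence eta some tail of it is eta-close modulo finite, then for each
   continuous g : [0,oo) -> [0,1] the functions g o flow(s_a) are, for large a, equal
   modulo functions vanishing at infinity.  So F(p)(g) := p(g o flow(s_a)), with a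
   large depending on g, defines a self-map F of K, and (-s_a) defines its inverse.
   Under CH a recursion of length omega_1 on nested intervals of R^nat modulo finite,
   with widths below an enumeration of all positive sequences and a binary choice at
   each stage, yields 2^aleph_1 such nets with distinct limits.
   Conversely, Tietze extension and the separability of [0,1) give at most
   2^aleph_0 = aleph_1 elements of C(K), hence at most 2^aleph_1 automorphisms, and
   homeomorphisms act faithfully on C(K) by composition.  Finally a trivial map is
   determined by countably many reals, so there are too few trivial maps. *)
Require Import Defs.
From mathcomp Require Import all_boot all_order all_algebra.
From mathcomp Require Import complex wochoice.
From mathcomp Require Import all_classical all_reals all_analysis.
From mathcomp Require Import ring lra.

Set Implicit Arguments.
Unset Strict Implicit.
Unset Printing Implicit Defensive.

Import Order.TTheory GRing.Theory Num.Theory.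
Import numFieldNormedType.Exports.

Local Open Scope classical_set_scope.
Local Open Scope ring_scope.

(** * Nested intervals of sequences modulo finite *)

Section WellOrder.
Variables (W : Type) (le : rel W).
Hypothesis le_wo : well_order le.

Definition wo_lt : rel W := fun x y => ~~ le y x.

Lemma wo_min (P : W -> Prop) : (exists x, P x) ->
  exists2 z, P z & forall y, P y -> le z y.
Proof.
move=> [x Px]; have [|z [[Az lz] _]] := le_wo (A := fun y => `[< P y >]).
  by exists x; apply/asboolP.
by exists z => [|y Py]; [exact/asboolP | apply: lz; exact/asboolP].
Qed.

Lemma wo_total x y : le x y || le y x.
Proof.
have [|z zxy zl] := wo_min (P := fun z => z = x \/ z = y); first by exists x; left.
by case: zxy => <-; apply/orP; [left | right]; apply: zl; [right|left].
Qed.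

Lemma wo_refl x : le x x.
Proof. by have := wo_total x x; rewrite orbb. Qed.

Lemma wo_anti x y : le x y -> le y x -> x = y.
Proof.
move=> xy yx; pose A : {pred W} := fun z => `[< z = x \/ z = y >].
have [|z [_ uz]] := le_wo (A := A); first by exists x; apply/asboolP; left.
have mx : minimum_of le A x.
  split; first by apply/asboolP; left.
  by move=> t /asboolP [->|->] //; exact: wo_refl.
have my : minimum_of le A y.
  split; first by apply/asboolP; right.
  by move=> t /asboolP [->|->] //; exact: wo_refl.
by rewrite -(uz _ mx) -(uz _ my).
Qed.

Lemma wo_trans x y z : le x y -> le y z -> le x z.
Proof.
move=> xy yz.
have [|m] := wo_min (P := fun t => [\/ t = x, t = y | t = z]).
  by exists x; apply: Or31.
move=> [] -> ml; first by apply: ml; apply: Or33.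
  by rewrite (wo_anti xy _) //; apply: ml; apply: Or31.
by rewrite -(wo_anti yz _) //; apply: ml; apply: Or32.
Qed.

Lemma wo_ltW x y : wo_lt x y -> le x y.
Proof. by rewrite /wo_lt => /negPf h; have := wo_total x y; rewrite h orbF. Qed.

Lemma wo_le_eqVlt x y : le x y -> x = y \/ wo_lt x y.
Proof.
by rewrite /wo_lt; case yx: (le y x) => xy; [left; exact: wo_anti | right].
Qed.

Lemma wo_lt_wf : well_founded wo_lt.
Proof.
move=> x; apply: contrapT => nx.
have [|z nz zm] := wo_min (P := fun t => ~ Acc wo_lt t); first by exists x.
apply: nz; constructor => y yz; apply: contrapT => ny.
by move/negP: yz; apply; exact: zm.
Qed.

(** Transfinite recursion without dependent types: [step] receives the history as a total function,
    equal to [s0] off the predecessors of [a]. *)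
Lemma wo_lt_rec (S : Type) (s0 : S) (step : W -> (W -> S) -> S) :
  exists st : W -> S,
    forall a, st a = step a (fun c => if wo_lt c a then st c else s0).
Proof.
pose F a (rec : forall c, wo_lt c a -> S) : S :=
  step a (fun c => match sumbool_of_bool (wo_lt c a) with
                   | left h => rec c h | right _ => s0 end).
exists (Fix wo_lt_wf (fun=> S) F) => a.
rewrite Fix_eq; last first.
  move=> b f g fg; rewrite /F; congr (step b _); apply/funext => c.
  by case: sumbool_of_bool.
rewrite {1}/F; congr (step a _); apply/funext => c.
by case: sumbool_of_bool => -> .
Qed.

End WellOrder.

(** * Countable families of intervals modulo finite *)

Section Intervals.
Variable R : realType.

(** There are no countable gaps modulo finite: for each [k] the intervals up to index [k] overlap at
    almost every [n], so the level usable at [n] tends to infinity with [n]. *)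
Lemma interval_diagonal (A B : nat -> nat -> R) :
  (forall i j, \forall n \near \oo, A i n < B j n) ->
  exists ab : (nat -> R) * (nat -> R),
    (forall n, ab.1 n < ab.2 n) /\
    forall i, \forall n \near \oo, A i n <= ab.1 n /\ ab.2 n <= B i n.
Proof.
move=> AB.
pose good k n := forall i j, (i <= k)%N -> (j <= k)%N -> A i n < B j n.
have goodnear k : \forall n \near \oo, good k n.
  have : \forall n \near \oo, forall i : 'I_k.+1, forall j : 'I_k.+1, A i n < B j n.
    by apply: filter_forall => i; apply: filter_forall => j.
  apply: filterS => n h i j ik jk.
  by have := h (Ordinal (n:=k.+1) (m:=i) ik) (Ordinal (n:=k.+1) (m:=j) jk).
(* At [n], use the largest [k <= n] for which the first [k] intervals meet at [n]. *)
have pick n : exists uv : R * R, uv.1 < uv.2 /\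
    forall k, (k <= n)%N -> good k n ->
      forall i, (i <= k)%N -> A i n <= uv.1 /\ uv.2 <= B i n.
  have [[k0 k0n g0]|ng] := pselect (exists2 k, (k <= n)%N & good k n); last first.
    by exists (0, 1); split => //= k kn gk; case: ng; exists k.
  have ex : exists k, (k <= n)%N && `[< good k n >].
    by exists k0; rewrite k0n; apply/asboolP.
  have bd k : (k <= n)%N && `[< good k n >] -> (k <= n)%N by case/andP.
  have [K /andP[_ /asboolP gK] maxK] := ex_maxnP ex bd.
  have [i _ maxi] := @arg_maxP _ _ _ (@ord0 K) predT (fun i => A i n) isT.
  have [j _ minj] := @arg_minP _ _ _ (@ord0 K) predT (fun i => B i n) isT.
  exists (A i n, B j n); split => /=.
    by apply: gK; rewrite -ltnS ltn_ord.
  move=> k kn gk l lk.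
  have lK : (l < K.+1)%N.
    by rewrite ltnS (leq_trans lk)// maxK// kn; apply/asboolP.
  by split; [exact: (maxi (Ordinal lK)) | exact: (minj (Ordinal lK))].
have [f fP] := choice pick.
exists (fun n => (f n).1, fun n => (f n).2); split => [n|i] /=.
  exact: (fP n).1.
near=> n; apply: ((fP n).2 i) => //; near: n; [exact: nbhs_infty_ge | exact: goodnear].
Unshelve. all: by end_near. Qed.

End Intervals.

(** * A binary tree of nested intervals of height omega_1 *)

Section Branches.
Variables (R : realType) (W : Type) (le : rel W).
Hypothesis le_omega1 : is_omega1 le.
Variable eta : W -> nat -> R.
Hypothesis eta_gt0 : forall a n, 0 < eta a n.

Let le_wo : well_order le. Proof. by case: le_omega1. Qed.
Local Notation wlt := (wo_lt le).
Local Notation state := ((nat -> R) * (nat -> R))%type.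

Definition refines (a : W) (st : W -> state) (ab : state) : Prop :=
  [/\ forall n, ab.1 n < ab.2 n,
      forall n, ab.2 n <= ab.1 n + eta a n
    & forall c, wlt c a ->
        \forall n \near \oo, (st c).1 n <= ab.1 n /\ ab.2 n <= (st c).2 n].

(** The outer thirds leave the middle third as a gap, which keeps two branches apart at all later
    stages. *)
Definition third (b : bool) (ab : state) : state :=
  if b then (fun n => (ab.1 n + 2 * ab.2 n) / 3, ab.2)
  else (ab.1, fun n => (2 * ab.1 n + ab.2 n) / 3).

(** A stage has countably many predecessors, so the diagonal argument gives an interval inside all
    of theirs; lowering its upper end makes it narrow enough. *)
Lemma refines_exists a (st : W -> state) :
  (forall c d, wlt c a -> wlt d a ->
     \forall n \near \oo, (st c).1 n < (st d).2 n) ->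
  exists ab, refines a st ab.
Proof.
move=> h; suff [ab [ab12 abP]] : exists ab : state, (forall n, ab.1 n < ab.2 n) /\
    forall c, wlt c a -> \forall n \near \oo, (st c).1 n <= ab.1 n /\ ab.2 n <= (st c).2 n.
  exists (ab.1, fun n => Num.min (ab.2 n) (ab.1 n + eta a n)); split => /=.
  - by move=> n; rewrite lt_min ab12 ltrDl eta_gt0.
  - by move=> n; rewrite ge_min lexx orbT.
  - move=> c /abP; apply: filterS => n [-> le2]; split => //.
    by rewrite ge_min le2.
have [[c0 c0a]|no] := pselect (exists c, wlt c a); last first.
  by exists (fun=> 0, fun=> 1); split => // c ca; case: no; exists c.
have [_ _ /(_ a)/countable_injP [f finj]] := le_omega1.
(* An enumeration of the predecessors of [a]: [g i] is the one with code [i], with [c0] as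
   default. *)
have /choice [g gP] : forall i, exists d, wlt d a /\
    forall c, wlt c a -> f c = i -> d = c.
  move=> i.
  have [[d [da fd]]|no] := pselect (exists d, wlt d a /\ f d = i).
    exists d; split => // c ca fc; apply: finj; rewrite ?inE ?fc //=; exact: wo_ltW.
  by exists c0; split => // c ca fc; case: no; exists c.
have ga i : wlt (g i) a := (gP i).1.
have [|ab [ab12 abP]] := @interval_diagonal R (fun i => (st (g i)).1) (fun i => (st (g i)).2).
  by move=> i j; exact: h.
exists ab; split => // c ca; rewrite -((gP (f c)).2 c ca erefl); exact: abP.
Qed.

(** The value of [xget] depends only on the set of refinements, so two branches with the same past
    choose their thirds inside the same interval. *)
Definition branch_step (x : W -> bool) (a : W) (st : W -> state) : state :=
  third (x a) (xget (fun=> 0, fun=> 1) (refines a st)).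

Lemma branch_family_exists : exists st : (W -> bool) -> W -> state,
  forall x a, st x a =
    branch_step x a (fun c => if wlt c a then st x c else (fun=> 0, fun=> 0)).
Proof.
have [st stP] := choice (fun x => wo_lt_rec le_wo (fun=> 0 : R, fun=> 0 : R) (branch_step x)).
by exists st.
Qed.

Lemma third_bounds b (ab : state) n : ab.1 n < ab.2 n ->
  [/\ ab.1 n <= (third b ab).1 n, (third b ab).2 n <= ab.2 n
    & (third b ab).1 n < (third b ab).2 n].
Proof. by rewrite /third; case: b => /= h; split; lra. Qed.

Section Family.
Variable st : (W -> bool) -> W -> state.
Hypothesis stE : forall x a, st x a =
    branch_step x a (fun c => if wlt c a then st x c else (fun=> 0, fun=> 0)).

Definition parent (x : W -> bool) (a : W) : state :=
  xget (fun=> 0, fun=> 1) (refines a (st x)).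

Lemma stE' x a : st x a = third (x a) (parent x a).
Proof.
rewrite {1}stE /branch_step /parent; congr (third _ (xget _ _)).
apply/seteqP; split => ab [h1 h2 h3]; split => // c ca.
  by have := h3 c ca; rewrite ca.
by rewrite ca; exact: h3.
Qed.

(** Induction on the stage: the earlier intervals are nested modulo finite and nondegenerate, hence
    overlap pairwise, so a refinement exists and [xget] does not return its default. *)
Lemma parentP x a : refines a (st x) (parent x a).
Proof.
elim/(well_founded_ind (wo_lt_wf le_wo)): a => a IH.
rewrite /parent; case: xgetP => // no.
have [|ab rab] := @refines_exists a (st x); last by case: (no ab).
have step c d : wlt c d -> wlt d a ->
    \forall n \near \oo, (st x c).1 n <= (st x d).1 n /\ (st x d).2 n <= (st x c).2 n.
  move=> cd da; have [lt12 _ /(_ c cd)] := IH d da.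
  apply: filterS => n; rewrite (stE' x d).
  have [] := third_bounds (x d) (lt12 n); lra.
have self d : wlt d a -> forall n, (st x d).1 n < (st x d).2 n.
  move=> da n; have [lt12 _ _] := IH d da.
  by rewrite stE'; have [] := third_bounds (x d) (lt12 n).
move=> c d ca da; have [cd|/negPn dc] := boolP (wlt c d).
  by have := step c d cd da; apply: filterS => n [h _]; exact: le_lt_trans h (self d da n).
have [->|{}dc] := wo_le_eqVlt le_wo dc; first by apply: nearW => n; exact: self.
by have := step d c dc ca; apply: filterS => n [_ h]; exact: lt_le_trans (self c ca n) h.
Qed.

Lemma parent_st x a n :
  [/\ (parent x a).1 n <= (st x a).1 n, (st x a).2 n <= (parent x a).2 n
    & (st x a).1 n < (st x a).2 n].
Proof.
have [lt12 _ _] := parentP x a.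
by rewrite stE'; exact: third_bounds (lt12 n).
Qed.

Lemma st_nested x c d : le c d ->
  \forall n \near \oo, (st x c).1 n <= (st x d).1 n /\ (st x d).2 n <= (st x c).2 n.
Proof.
move=> /(wo_le_eqVlt le_wo) [->|cd]; first by apply: nearW => n; split.
have [_ _ /(_ c cd)] := parentP x d; apply: filterS => n.
by have [] := parent_st x d n; lra.
Qed.

Lemma st_width x a n : (st x a).2 n <= (st x a).1 n + eta a n.
Proof.
have [_ /(_ n) w _] := parentP x a.
by have [] := parent_st x a n; lra.
Qed.

Lemma st_agree x y a : (forall c, wlt c a -> x c = y c) ->
  forall c, wlt c a -> st x c = st y c.
Proof.
move=> xy; elim/(well_founded_ind (wo_lt_wf le_wo)) => c IH ca.
rewrite [LHS]stE [RHS]stE /branch_step xy //; congr (third _ (xget _ (refines _ _))).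
apply/funext => d; case: ifP => // dc; apply: IH => //.
apply/negP => ad; have : le c d by exact: (wo_trans le_wo (wo_ltW le_wo ca) ad).
by move: dc; rewrite /wo_lt => /negPf ->.
Qed.

End Family.

(** Take for [s x a] the lower end of the interval at stage [a]. Later lower ends stay in that
    interval, of width at most [eta a]; branches that first differ at [a] enter opposite thirds of
    one parent. *)
Lemma omega1_branches : exists s : (W -> bool) -> W -> nat -> R,
  (forall x c d, le c d -> \forall n \near \oo, `|s x d n - s x c n| <= eta c n) /\
  (forall (x y : W -> bool) a, (forall c, wlt c a -> x c = y c) -> x a -> ~~ y a ->
     exists2 rho : nat -> R, (forall n, 0 < rho n) &
       forall d, le a d -> \forall n \near \oo, rho n <= s x d n - s y d n).
Proof.
have [st stP] := branch_family_exists.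
exists (fun x a => (st x a).1); split.
  move=> x c d /(st_nested stP x); apply: filterS => n [h1 h2].
  have [_ _ h3] := parent_st stP x d n; have h4 := st_width stP x c n.
  by rewrite ger0_norm; lra.
move=> x y a xy xa ya.
have pxy : parent st x a = parent st y a.
  rewrite /parent; congr (xget _ _).
  have ag := st_agree stP xy.
  by apply/seteqP; split => ab [h1 h2 h3]; split => // c ca;
    [rewrite -ag | rewrite ag] => //; exact: h3.
have [lt12 _ _] := parentP stP x a.
(* The length of the middle third of the common parent. *)
exists (fun n => ((parent st x a).2 n - (parent st x a).1 n) / 3).
  by move=> n; have := lt12 n; lra.
move=> d ad; near=> n.
have [h1 _] : (st x a).1 n <= (st x d).1 n /\ (st x d).2 n <= (st x a).2 n.
  by near: n; exact: st_nested.
have [_ h2] : (st y a).1 n <= (st y d).1 n /\ (st y d).2 n <= (st y a).2 n.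
  by near: n; exact: st_nested.
have [_ _ h3] := parent_st stP y d n.
move: h1 h2; rewrite (stE' stP x a) (stE' stP y a) xa (negbTE ya) -pxy /third /=.
move=> h1 h2.
by have := lt12 n; lra.
Unshelve. all: by end_near. Qed.

End Branches.

(** * A flow on the line fixing the integers *)

Section RealFlow.
Variable R : realType.
Implicit Types (x y u r s t : R).

(** Away from the integers a single piece is in use locally; near an integer [m] the pieces [m - 1]
    and [m] both occur, and they have the same value at [m]. *)
Lemma floor_glue_continuous (h : int -> R -> R) :
  (forall m, continuous (h m)) ->
  (forall m, h (m - 1) m%:~R = h m m%:~R) ->
  continuous (fun x => h (Num.floor x) x).
Proof.
move=> ch hh x; set m := Num.floor x.
have /andP[mx xm] := floor_itv x; rewrite -/m in mx xm.
apply/cvgrPdist_lt => e e0.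
have /cvgrPdist_lt/(_ e e0) h0 := ch m x.
have [->|mx'] := eqVneq x m%:~R.
  have /cvgrPdist_lt/(_ e e0) h1 := ch m m%:~R.
  have /cvgrPdist_lt/(_ e e0) h2 := ch (m - 1) m%:~R.
  near=> y.
  have ym : y < (m + 1)%:~R.
    by near: y; apply: lt_nbhsl; rewrite intrD ltrDl.
  have my : (m - 1)%:~R < y.
    by near: y; apply: lt_nbhsr; rewrite ltr_int ltrBlDr ltrDl.
  have [le_my|lt_ym] := lerP m%:~R y.
    rewrite (@floor_def _ y m) ?le_my ?ym//; rewrite intrKfloor.
    by near: y.
  rewrite (@floor_def _ y (m - 1)) ?subrK ?(ltW my) ?lt_ym//.
  rewrite intrKfloor -hh.
  by near: y.
have {}mx : m%:~R < x by rewrite lt_neqAle eq_sym mx' mx.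
near=> y.
have ym : y < (m + 1)%:~R by near: y; exact: lt_nbhsl.
have my : m%:~R < y by near: y; exact: lt_nbhsr.
rewrite (@floor_def _ y m) ?(ltW my) ?ym// -/m.
by near: y.
Unshelve. all: by end_near. Qed.

(** Retraction onto the unit interval, through which [phi t] becomes continuous on the whole
    line. *)
Definition clamp u : R := Num.max 0 (Num.min 1 u).

Lemma clamp_itv u : 0 <= clamp u <= 1.
Proof. by rewrite /clamp le_max lexx /= ge_max ler01 ge_min lexx. Qed.

Lemma clamp_id u : 0 <= u <= 1 -> clamp u = u.
Proof. by case/andP=> h0 h1; rewrite /clamp (min_idPr h1) (max_idPr h0). Qed.

Lemma clamp_continuous : continuous (clamp : R -> R^o).
Proof.
have -> : clamp = (cst 0 : R -> R^o) \max ((cst 1 : R -> R^o) \min (id : R -> R^o)) by [].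
move=> u; apply: continuous_max; first exact: cst_continuous.
by apply: continuous_min; [exact: cst_continuous | exact: cvg_id].
Qed.

(* In the coordinate [log (u / (1 - u))] of the open unit interval this is the
   translation by [t]. *)
Definition phi t u : R := let v := clamp u in v / (v + (1 - v) * expR (- t)).

Lemma phi_den t v : 0 <= v <= 1 -> 0 < v + (1 - v) * expR (- t).
Proof.
move=> /andP[v0 v1]; have e0 := expR_gt0 (- t).
have [->|vn0] := eqVneq v 0; first by rewrite subr0 add0r mul1r.
have : 0 < v by rewrite lt_neqAle eq_sym vn0.
have : 0 <= (1 - v) * expR (- t) by rewrite mulr_ge0 ?subr_ge0 ?expR_ge0.
lra.
Qed.

Lemma phi_0 t : phi t 0 = 0.
Proof. by rewrite /phi clamp_id ?lexx ?ler01//= mul0r. Qed.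

Lemma phi_1 t : phi t 1 = 1.
Proof. by rewrite /phi clamp_id ?lexx ?ler01//= subrr mul0r addr0 divr1. Qed.

Lemma phi_id u : 0 <= u <= 1 -> phi 0 u = u.
Proof.
by move=> hu; rewrite /phi clamp_id//= oppr0 expR0 mulr1 addrC subrK divr1.
Qed.

Lemma phi_itv t u : 0 <= u <= 1 -> 0 <= phi t u <= 1.
Proof.
move=> hu; rewrite /phi clamp_id//=; have d0 := phi_den t hu.
case/andP: hu => h0 h1; rewrite divr_ge0 ?(ltW d0)//=.
rewrite ler_pdivrMr// mul1r lerDl mulr_ge0 ?subr_ge0//; exact: expR_ge0.
Qed.

Lemma phi_lt1 t u : 0 <= u < 1 -> phi t u < 1.
Proof.
move=> /andP[h0 h1]; have hu : 0 <= u <= 1 by rewrite h0 ltW.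
rewrite /phi clamp_id//=; have d0 := phi_den t hu.
rewrite ltr_pdivrMr// mul1r ltrDl mulr_gt0 ?subr_gt0//; exact: expR_gt0.
Qed.

Lemma phi_comp s t u : 0 <= u <= 1 -> phi s (phi t u) = phi (s + t) u.
Proof.
move=> hu; have hv := phi_itv t hu.
have d3 := phi_den s hv; have d1 := phi_den t hu; have d2 := phi_den (s + t) hu.
rewrite {1}/phi clamp_id//=; move: d3; rewrite /phi !clamp_id//=.
move: d1 d2; rewrite opprD expRD.
set a := expR (- s); set b := expR (- t) => d1 d2 d3.
by field; rewrite !gt_eqF//=; move: d2; rewrite mulrCA mulrA; lra.
Qed.

Lemma phi_mono s t u : 0 <= u <= 1 -> s <= t -> phi s u <= phi t u.
Proof.
move=> hu st; rewrite /phi !clamp_id//=.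
case/andP: (hu) => h0 h1.
apply: ler_wpM2l => //; rewrite lef_pV2 ?posrE ?phi_den//.
by rewrite lerD2l ler_wpM2l ?subr_ge0// ler_expR lerN2.
Qed.

Lemma phi_half_gt t : 0 < t -> 2^-1 < phi t 2^-1.
Proof.
move=> t0; have hu : 0 <= (2^-1 : R) <= 1 by lra.
have d := phi_den t hu; rewrite /phi clamp_id//=.
rewrite ltr_pdivlMr//.
have : expR (- t) < 1 by rewrite expR_lt1 oppr_lt0.
lra.
Qed.

Lemma phi_continuous t : continuous (phi t).
Proof.
move=> u; have cu : clamp v @[v --> u] --> clamp u := @clamp_continuous u.
apply: cvgM => //; apply: cvgV => //.
  by rewrite gt_eqF// phi_den// clamp_itv.
apply: cvgD => //; apply: cvgM; last exact: cvg_cst.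
by apply: cvgB => //; exact: cvg_cst.
Qed.

Lemma cvg_comp_continuous (T : Type) (F : set_system T) (f : T -> R) l (g : R -> R) :
  continuous g -> f x @[x --> F] --> l -> g (f x) @[x --> F] --> g l.
Proof. by move=> cg fl; apply: (@cvg_comp _ _ _ f g) fl _; exact: cg. Qed.

Lemma phi_continuous2 r u : phi ru.1 ru.2 @[ru --> (r, u)] --> phi r u.
Proof.
have cr : ru.1 @[ru --> (r, u)] --> r by exact: cvg_fst.
have cu : ru.2 @[ru --> (r, u)] --> u by exact: cvg_snd.
have c1 : expR (- ru.1) @[ru --> (r, u)] --> expR (- r).
  by apply: cvg_comp_continuous; [exact: continuous_expR | exact: cvgN].
have c2 : clamp ru.2 @[ru --> (r, u)] --> clamp u.
  exact: cvg_comp_continuous (@clamp_continuous) cu.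
apply: cvgM => //; apply: cvgV; first by rewrite gt_eqF// phi_den// clamp_itv.
apply: cvgD => //; apply: cvgM => //.
by apply: cvgB => //; exact: cvg_cst.
Qed.

(** Since [phi 0] is the identity on the unit interval and [phi] is jointly continuous, compactness
    of the interval makes the estimate uniform in [u]. *)
Lemma phi_modulus (G : R -> R) (a e : R) : continuous G -> 0 < e ->
  exists2 d, 0 < d & forall r, `|r| <= d -> forall u, 0 <= u <= 1 ->
    `|G (a + phi r u) - G (a + u)| <= e.
Proof.
move=> cG e0.
have /compact_near_coveringP cov := @segment_compact R 0 1.
have := cov R (nbhs (0 : R)) (fun r u => `|G (a + phi r u) - G (a + u)| <= e) _.
case.
  move=> u; rewrite /= in_itv /= => hu.
  have cr : ur.2 @[ur --> (u, 0 : R)] --> (0 : R) by exact: cvg_snd.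
  have cu : ur.1 @[ur --> (u, 0 : R)] --> u by exact: cvg_fst.
  have c2 : phi ur.2 ur.1 @[ur --> (u, 0 : R)] --> phi 0 u.
    apply: (@cvg_comp _ _ _ (fun ur : R * R => (ur.2, ur.1)) (fun ru => phi ru.1 ru.2)).
      exact: cvg_pair cr cu.
    exact: phi_continuous2.
  have cG1 : G (a + phi ur.2 ur.1) @[ur --> (u, 0 : R)] --> G (a + phi 0 u).
    by apply: cvg_comp_continuous => //; apply: cvgD c2; exact: cvg_cst.
  have cG2 : G (a + ur.1) @[ur --> (u, 0 : R)] --> G (a + u).
    by apply: cvg_comp_continuous => //; apply: cvgD cu; exact: cvg_cst.
  have c0 : G (a + phi ur.2 ur.1) - G (a + ur.1) @[ur --> (u, 0 : R)] --> (0 : R).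
    by have := cvgB cG1 cG2; rewrite phi_id// subrr; exact.
  move/cvgrPdist_lt: c0 => /(_ e e0).
  by apply: filterS => ur; rewrite sub0r normrN => /ltW.
move=> d /= d0 hd; exists (d / 2); first by rewrite divr_gt0.
move=> r rd u hu; apply: (hd r); last by rewrite /= in_itv.
by rewrite /= sub0r normrN; apply: (le_lt_trans rd); rewrite ltr_pdivrMr// ltr_pMr// ltr1n.
Qed.

(* [t n] is the time spent flowing on [n, n+1]; only [y >= 0] matters. *)
Definition flow (t : nat -> R) y : R :=
  (Num.floor y)%:~R + phi (t `|Num.floor y|%N) (y - (Num.floor y)%:~R).

Lemma frac_itv y : 0 <= y - (Num.floor y)%:~R < 1.
Proof. by have := floor_itv y; rewrite intrD => /andP[h1 h2]; lra. Qed.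

Lemma frac_itvW y : 0 <= y - (Num.floor y)%:~R <= 1.
Proof. by have := frac_itv y; lra. Qed.

(** Each [phi t] maps [0,1) into itself. As integer parts are kept, flow times add under composition
    and points far out stay far out. *)
Lemma floor_flow (t : nat -> R) y : Num.floor (flow t y) = Num.floor y.
Proof.
apply: floor_def; rewrite /flow intrD.
have /andP[h0 _] := phi_itv (t `|Num.floor y|%N) (frac_itvW y).
have h1 := phi_lt1 (t `|Num.floor y|%N) (frac_itv y).
by apply/andP; split; lra.
Qed.

Lemma flowD (s t : nat -> R) y : flow s (flow t y) = flow (s \+ t) y.
Proof.
rewrite {1}/flow floor_flow /flow; congr (_ + _).
by rewrite [X in phi _ X](_ : _ = phi (t `|Num.floor y|%N) (y - (Num.floor y)%:~R));
  [rewrite phi_comp// frac_itvW | ring].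
Qed.

Lemma flow_id y : flow (fun=> 0) y = y.
Proof. by rewrite /flow phi_id ?frac_itvW//; ring. Qed.

Lemma flow_continuous (t : nat -> R) : continuous (flow t).
Proof.
apply: (@floor_glue_continuous (fun m y => m%:~R + phi (t `|m|%N) (y - m%:~R))).
  move=> m y; apply: cvgD; first exact: cvg_cst.
  apply: (@continuous_comp _ _ _ (fun y => y - m%:~R) (phi _)); last exact: phi_continuous.
  by apply: cvgB; [exact: cvg_id | exact: cvg_cst].
move=> m; rewrite subrr phi_0 addr0.
rewrite [X in phi _ X](_ : _ = 1) ?phi_1; rewrite intrB; ring.
Qed.

End RealFlow.

(** * The remainder of the half-open interval *)

Section ProductCube.
Variables (I : choiceType) (T : topologicalType).

Lemma ptws_cvg (F : set_system {ptws I -> T}) (f : {ptws I -> T}) :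
  Filter F -> (forall i, (fun g => g i) @ F --> f i) -> F --> f.
Proof.
move=> FF h; apply/cvg_sup => i A [B [[C oC <-] Cfi] BA].
by apply: filterS BA _; apply: h; exact: open_nbhs_nbhs.
Qed.

Lemma ptws_eval_continuous (i : I) : continuous (fun f : {ptws I -> T} => f i).
Proof. exact: (@proj_continuous I (fun=> T) i). Qed.

Lemma ptws_continuous (Y : topologicalType) (F : Y -> {ptws I -> T}) :
  (forall i, continuous (fun y => F y i)) -> continuous F.
Proof. by move=> h y; apply: ptws_cvg => i; exact: h. Qed.

Lemma closure_ptws_eval (A : set {ptws I -> T}) q i (C : set T) :
  closure A q -> closed C -> (forall f, A f -> C (f i)) -> C (q i).
Proof.
move=> Aq cC h.
have cl : closed [set f : {ptws I -> T} | C (f i)].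
  by apply: (@preimage_closed _ _ (fun f : {ptws I -> T} => f i)) => //;
    move=> f _; exact: ptws_eval_continuous.
by apply: cl; apply: closure_subset Aq => f; exact: h.
Qed.

End ProductCube.

(** * Points of beta X and of the remainder as points of the cube *)

Section BetaGeneral.
Variables (R : realType) (X : topologicalType).
Local Notation U := (unit_map R X).
Local Notation cube := {ptws U -> R^o}.
Local Notation eval := (@beta_eval R X).

Lemma unit_map_eq (g h : U) : sval g =1 sval h -> g = h.
Proof.
case: g h => [g pg] [h ph] /= /funext gh; subst h.
by congr exist; exact: Prop_irrelevance.
Qed.

Lemma beta_eval_continuous : continuous eval.
Proof.
by apply: ptws_continuous => g; have [cg _] := svalP g.
Qed.

Lemma cube_hausdorff : hausdorff_space cube.
Proof. by apply: (@hausdorff_product U (fun=> R^o)) => _; exact: norm_hausdorff. Qed.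

Lemma cube_compact : compact [set f : cube | forall g, `[0, 1]%classic (f g)].
Proof.
apply: (@tychonoff U (fun=> R^o) (fun=> `[0, 1]%classic)) => _.
exact: segment_compact.
Qed.

(** [bcoord p g] is the value at [p] of the extension of [g] to beta X. *)
Definition bcoord (p : remainder R X) : cube := \val (\val p).

Definition in_remainder (q : cube) : Prop :=
  closure (range eval) q /\ forall x, q <> eval x.

Lemma bcoordP p : in_remainder (bcoord p).
Proof.
split; first exact: set_mem (valP (\val p)).
move=> x qx; have := set_mem (valP p); apply.
exists x => //; exact/val_inj.
Qed.

Lemma bcoord_inj : injective bcoord.
Proof. by move=> p p' pp'; apply/val_inj/val_inj. Qed.

Lemma bcoord_surj q : in_remainder q -> exists p, bcoord p = q.
Proof.
move=> [cq nq].
pose b : beta R X := SigSub (mem_set cq).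
have nb : (~` range (@beta_in R X)) b.
  by move=> [x _ xb]; apply: (nq x); rewrite -[q]/(\val b) -xb.
by exists (SigSub (mem_set nb)).
Qed.

Lemma bcoord_continuous : continuous bcoord.
Proof.
move=> p; apply: (@continuous_comp _ _ _ (fun p : remainder R X => \val p : beta R X)
  (fun b : beta R X => \val b : cube)).
  exact: (@initial_continuous (remainder R X) (beta R X) \val).
exact: (@initial_continuous (beta R X) cube \val).
Qed.

Lemma bcoord_eval_continuous g : continuous (fun p => bcoord p g : R^o).
Proof.
move=> p; have c1 : bcoord z @[z --> p] --> bcoord p := @bcoord_continuous p.
have c2 : (fun f : cube => f g) @ bcoord p --> (bcoord p g : R^o).
  exact: ptws_eval_continuous.
exact: cvg_comp c1 c2.
Qed.

Lemma continuous_bcoord (Y : topologicalType) (F : Y -> remainder R X) :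
  (forall g, continuous (fun y => bcoord (F y) g)) -> continuous F.
Proof.
move=> h.
apply: (@continuous_comp_initial (remainder R X) Y (beta R X) \val F).
apply: (@continuous_comp_initial (beta R X) Y cube \val (\val \o F)).
exact: ptws_continuous.
Qed.

(** The cube is compact, so the images of the [z n] have a cluster point, and a closed condition
    that holds eventually along the sequence passes to it. *)
Lemma cluster_sequence (z : nat -> X) :
  exists2 q : cube, closure (range eval) q &
    forall (h : U) c, (\forall n \near \oo, sval h (z n) = c) -> q h = c.
Proof.
have [|q [_ clq]] := @cube_compact ((eval \o z) @ \oo) _.
  exists 0%N => // n _ g /=.
  by have [_ /(_ (z n))] := svalP g; rewrite in_itv.
exists q; first by move: clq; rewrite clusterE; apply; exists 0%N => // n _; exists (z n).
move=> h c hc.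
have cl : closure [set f : cube | f h = c] q.
  by move: clq; rewrite clusterE; apply; exact: hc.
by apply: (closure_ptws_eval (C := [set c]) cl) => //; exact: closed_eq.
Qed.

End BetaGeneral.

(** * The interval [0,1) as a half-line, and the flow on it *)

Section HalfLine.
Variable R : realType.
Local Notation X := (half_open_interval R).
Local Notation U := (unit_map R X).
Local Notation cube := {ptws U -> R^o}.
Local Notation eval := (@beta_eval R X).

Definition pos (x : X) : R := \val x.

(** The homeomorphism of [0,1) onto [0,oo); its inverse [ofH] is made total by sending negative
    reals to 0. *)
Definition toH (x : X) : R := pos x / (1 - pos x).

Lemma ofH_subproof (y : R) :
  (`[0, 1[%classic : set R^o) (Num.max 0 y / (1 + Num.max 0 y)).
Proof.
have m0 : 0 <= Num.max 0 y by rewrite le_max lexx.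
rewrite /= in_itv /= divr_ge0 ?addr_ge0//= ltr_pdivrMr ?mul1r; last by lra.
by rewrite ltrDr ltr01.
Qed.

Definition ofH (y : R) : X := SigSub (mem_set (ofH_subproof y)).

Lemma pos_ofH y : pos (ofH y) = Num.max 0 y / (1 + Num.max 0 y).
Proof. by []. Qed.

Lemma pos_itv x : 0 <= pos x < 1.
Proof. by have := set_mem (valP x); rewrite /= in_itv. Qed.

Lemma toH_ge0 x : 0 <= toH x.
Proof. by have /andP[h0 h1] := pos_itv x; rewrite divr_ge0// subr_ge0 ltW. Qed.

Lemma toHK : cancel toH ofH.
Proof.
move=> x; apply: val_inj; rewrite -!/(pos _) pos_ofH (max_idPr (toH_ge0 x)) /toH.
have /andP[h0 h1] := pos_itv x.
by field; rewrite subrK oner_eq0 /= subr_eq0 gt_eqF.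
Qed.

Lemma ofHK y : 0 <= y -> toH (ofH y) = y.
Proof.
move=> y0; rewrite /toH pos_ofH (max_idPr y0).
by field; rewrite addrK oner_eq0 /= gt_eqF//; lra.
Qed.

Lemma toH_continuous : continuous toH.
Proof.
move=> x; have cv : pos z @[z --> x] --> pos x.
  exact: (@initial_continuous X R^o \val x).
have cd : 1 - pos z @[z --> x] --> 1 - pos x by apply: cvgB cv; exact: cvg_cst.
apply: cvgM cv (cvgV _ cd).
by have /andP[h0 h1] := pos_itv x; rewrite subr_eq0 gt_eqF.
Qed.

Lemma ofH_continuous : continuous ofH.
Proof.
apply: (@continuous_comp_initial X R R^o \val ofH) => y.
have cm : Num.max 0 z @[z --> y] --> Num.max 0 y.
  by apply: (@continuous_max R R^o (cst 0) id); [exact: cst_continuous | exact: cvg_id].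
have cd : 1 + Num.max 0 z @[z --> y] --> 1 + Num.max 0 y.
  by apply: cvgD cm; exact: cvg_cst.
apply: cvgM cm (cvgV _ cd).
have m0 : 0 <= Num.max 0 y by rewrite le_max lexx.
by rewrite gt_eqF//; lra.
Qed.

(** The part of X where [toH] is at most [N] is compact, so its image is closed in the cube and adds
    no point of the remainder to the closure. *)
Lemma in_remainder_away q (N : R) : in_remainder q ->
  closure (eval @` [set x | N < toH x]) q.
Proof.
move=> [cq nq].
have cK : compact (eval @` (ofH @` `[0, N]%classic)).
  apply: continuous_compact.
    by apply: continuous_subspaceT; exact: beta_eval_continuous.
  apply: continuous_compact; last exact: segment_compact.
  by apply: continuous_subspaceT; exact: ofH_continuous.
have {}cq : closure (eval @` [set x | N < toH x] `|` eval @` (ofH @` `[0, N]%classic)) q.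
  apply: closure_subset cq => _ [x _ <-].
  have [xN|Nx] := lerP (toH x) N; last by left; exists x.
  right; exists x => //; exists (toH x); last exact: toHK.
  by rewrite /= in_itv /= toH_ge0.
move: cq; rewrite closureU => -[//|].
rewrite -(closure_id _).1; last exact: compact_closed (@cube_hausdorff _ _) cK.
by move=> [x _ xq]; case: (nq x).
Qed.

(** A bound [e] on the difference of two coordinates is a closed condition; it holds on a tail of X,
    hence at [q]. *)
Lemma in_remainder_eq q (h h' : U) : in_remainder q ->
  (forall e, 0 < e -> exists N, forall x, N < toH x -> `|sval h x - sval h' x| <= e) ->
  q h = q h'.
Proof.
move=> rq hh; apply/eqP; rewrite -subr_eq0 -normr_le0; apply/ler_addgt0Pr => e e0.
have [N hN] := hh e e0; rewrite add0r.
have cA := in_remainder_away N rq.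
pose D (f : cube) : R := (f h : R) - (f h' : R).
have cD : continuous D.
  move=> f; have ch k : (fun f : cube => f k) @ f --> (f k : R).
    by exact: ptws_eval_continuous.
  exact: cvgB (ch h) (ch h').
have cN : continuous (fun f => `|D f| : R).
  move=> f; apply: (@continuous_comp _ _ _ D (fun r : R => `|r|)); first exact: cD.
  exact: norm_continuous.
have cl : closed [set f : cube | `|D f| <= e].
  apply: (@preimage_closed _ _ _ [set r | r <= e]); last exact: closed_le.
  by move=> f _; exact: cN.
by apply: cl; apply: closure_subset cA => _ [x Nx <-]; exact: hN.
Qed.

Lemma in_remainder_vanish q (h : U) N : in_remainder q ->
  (forall x, N < toH x -> sval h x = 0) -> q h = 0.
Proof.
move=> rq h0; have := in_remainder_away N rq => cA.
by apply: (closure_ptws_eval (C := [set 0]) cA); [exact: closed_eq | move=> _ [x /h0 + <-]].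
Qed.

Lemma plateau_subproof (N : R) : continuous (fun x : X => clamp (N + 1 - toH x) : R^o) /\
  forall x : X, 0 <= clamp (N + 1 - toH x) <= 1.
Proof.
split=> x; last exact: clamp_itv.
have c1 : N + 1 - toH y @[y --> x] --> N + 1 - toH x.
  have c0 : toH y @[y --> x] --> toH x := @toH_continuous x.
  by apply: cvgB c0; exact: cvg_cst.
exact: cvg_comp_continuous (@clamp_continuous R) c1.
Qed.

Definition plateau (N : R) : U := exist _ _ (plateau_subproof N).

Lemma plateau1 N x : toH x <= N -> sval (plateau N) x = 1.
Proof.
by move=> xN; rewrite /= /clamp (min_idPl _) ?(max_idPr _)//; lra.
Qed.

Lemma plateau0 N x : N + 1 < toH x -> sval (plateau N) x = 0.
Proof.
move=> xN; rewrite /= /clamp; apply/eqP; rewrite eq_le le_max lexx andbT.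
by rewrite ge_max lexx ge_min /=; apply/orP; right; lra.
Qed.

(** A point [x] of X is excluded by [plateau (toH x)], which takes the value 1 there. *)
Lemma in_remainderP q : closure (range eval) q ->
  (forall N, q (plateau N) = 0) -> in_remainder q.
Proof.
move=> cq h0; split=> // x qx; have := h0 (toH x).
by rewrite qx /beta_eval plateau1// => /eqP; rewrite oner_eq0.
Qed.

Definition xflow (t : nat -> R) (x : X) : X := ofH (flow t (toH x)).

Lemma flow_ge0 t (y : R) : 0 <= y -> 0 <= flow t y.
Proof. by move=> y0; rewrite -floor_ge0 floor_flow floor_ge0. Qed.

Lemma toH_xflow t x : toH (xflow t x) = flow t (toH x).
Proof. by rewrite ofHK// flow_ge0// toH_ge0. Qed.

Lemma xflow_continuous t : continuous (xflow t).
Proof.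
move=> x.
have c1 : flow t (toH y) @[y --> x] --> flow t (toH x).
  exact: cvg_comp_continuous (@flow_continuous R t) (@toH_continuous x).
exact: cvg_comp c1 (@ofH_continuous _).
Qed.

Lemma xflowD s t x : xflow s (xflow t x) = xflow (s \+ t) x.
Proof. by rewrite /xflow ofHK ?flowD// flow_ge0// toH_ge0. Qed.

Lemma pull_subproof t (g : U) : continuous (sval g \o xflow t) /\
  forall x, 0 <= (sval g \o xflow t) x <= 1.
Proof.
have [cg bg] := svalP g; split=> [x|x]; last exact: bg.
exact: cvg_comp (@xflow_continuous t x) (cg _).
Qed.

Definition pull t (g : U) : U := exist _ _ (pull_subproof t g).

Lemma pullD s t g : pull t (pull s g) = pull (s \+ t) g.
Proof. by apply: unit_map_eq => x; rewrite /= xflowD. Qed.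

Lemma pull0 g : pull (fun=> 0) g = g.
Proof. by apply: unit_map_eq => x; rewrite /= /xflow flow_id toHK. Qed.

Lemma closure_pull t q : closure (range eval) q ->
  closure (range eval) ((fun g => q (pull t g)) : cube).
Proof.
have cF : continuous (fun q : cube => (fun g => q (pull t g)) : cube).
  by apply: ptws_continuous => g; exact: ptws_eval_continuous.
move=> cq.
have cl : closed [set q : cube | closure (range eval) ((fun g => q (pull t g)) : cube)].
  by apply: (@preimage_closed _ _ (fun q : cube => (fun g => q (pull t g)) : cube)) ;
    [move=> ? _; exact: cF | exact: closed_closure].
apply: cl; apply: closure_subset cq => _ [x _ <-].
by apply: subset_closure; exists (xflow t x).
Qed.

End HalfLine.

(** * Limits of coherent nets of flows *)

Section LimitMaps.
Variables (R : realType) (W : Type) (le : rel W).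
Hypothesis le_wo : well_order le.
Hypothesis W_ne : inhabited W.
Local Notation X := (half_open_interval R).
Local Notation U := (unit_map R X).
Local Notation cube := {ptws U -> R^o}.
Local Notation eval := (@beta_eval R X).
Implicit Types (s : W -> nat -> R) (g h : U).

Definition coherent s := forall eta : nat -> R, (forall n, 0 < eta n) ->
  exists a, forall b, le a b -> \forall n \near \oo, `|s b n - s a n| <= eta n.

Definition wtail : set_system W := filter_from setT (fun a => [set b | le a b]).

Lemma wo_sup a b : exists c, le a c /\ le b c.
Proof.
case/orP: (wo_total le_wo a b) => h; first by exists b; split; last exact: wo_refl.
by exists a; split; first exact: wo_refl.
Qed.

Lemma wtail_proper : ProperFilter wtail.
Proof.
case: W_ne => w0; apply: filter_from_proper; last first.
  by move=> a _; exists a; exact: wo_refl.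
apply: filter_from_filter; first by exists w0.
move=> a b _ _; have [c [ac bc]] := wo_sup a b.
by exists c => // d cd; split; apply: (wo_trans le_wo _ cd).
Qed.

Lemma piece_of (x : X) : exists n : nat, toH x < n%:R + 1 /\
  Num.floor (toH x) = n%:Z /\ exists2 u : R, 0 <= u <= 1 & toH x = n%:R + u.
Proof.
have f0 : 0 <= Num.floor (toH x) by rewrite floor_ge0 toH_ge0.
have fE : Num.floor (toH x) = `|Num.floor (toH x)|%N by rewrite gez0_abs.
have := frac_itvW (toH x); have := floorD1_gt (toH x); rewrite fE intrD -pmulrn.
move=> h1 h2.
exists `|Num.floor (toH x)|%N; split=> //; split => //.
by exists (toH x - `|Num.floor (toH x)|%:R) => //; rewrite addrC subrK.
Qed.

(** Flow times up to [d n] change [g] by at most 1/(n+1) on [n, n+1]; the change vanishes at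
    infinity, so the remainder does not see it. *)
Lemma pull_modulus g : exists2 d : nat -> R, forall n, 0 < d n &
  forall r t : nat -> R, (\forall n \near \oo, `|r n| <= d n) ->
    forall q : cube, in_remainder q -> q (pull (r \+ t) g) = q (pull t g).
Proof.
pose G : R -> R := sval g \o @ofH R.
have cG : continuous G.
  have [cg _] := svalP g.
  by move=> y; exact: cvg_comp (@ofH_continuous R y) (cg _).
have /choice [d dP] : forall n : nat, exists d : R, 0 < d /\
    forall r, `|r| <= d -> forall u, 0 <= u <= 1 ->
      `|G (n%:R + phi r u) - G (n%:R + u)| <= n.+1%:R^-1.
  move=> n; have [|d d0 dP] := @phi_modulus R G n%:R (n.+1%:R^-1) cG.
    by rewrite invr_gt0.
  by exists d.
exists d => [n|r t rd q rq]; first exact: (dP n).1.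
apply: in_remainder_eq rq _ => e e0.
have [N1 _ hN1] := rd.
have [N2 _ hN2] := near_infty_natSinv_lt (PosNum e0).
exists (maxn N1 N2)%:R => x Nx.
have [n [xn [fx [u hu xE]]]] := piece_of x.
have Nn : (maxn N1 N2 <= n)%N.
  by rewrite -ltnS -(ltr_nat R); apply: lt_trans Nx _; rewrite -natr1.
move: Nn; rewrite geq_max => /andP[/hN1 /= hn /hN2 /= he].
have xflowE v : sval g (xflow v x) = G (n%:R + phi (v n) u).
  by rewrite /xflow /G /= /flow fx absz_nat -pmulrn xE (addrC _ u) addrK.
rewrite [X in `|X - _|]xflowE [X in `|_ - X|]xflowE.
rewrite -phi_comp//; apply: le_trans (ltW he).
by apply: (dP n).2 => //; exact: phi_itv.
Qed.

Lemma pull_stable s g : coherent s ->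
  exists a, forall b, le a b -> forall q : cube, in_remainder q ->
    q (pull (s b) g) = q (pull (s a) g).
Proof.
move=> cs; have [d d0 dP] := pull_modulus g.
have [a aP] := cs d d0; exists a => b ab q rq.
rewrite -(dP (fun n => s b n - s a n) (s a) (aP b ab) q rq).
by congr (q (pull _ g)); apply/funext => n; rewrite /= subrK.
Qed.

(** Each coordinate of the net of flows is eventually constant, from a stage that may depend on [g]
    but not on [p]. *)
Definition limit_of s (F : remainder R X -> remainder R X) :=
  forall g, exists a, forall b, le a b -> forall p, bcoord (F p) g = bcoord p (pull (s b) g).

Lemma limit_exists s : coherent s -> exists2 F, continuous F & limit_of s F.
Proof.
move=> cs; have /choice [A AP] := fun g => pull_stable g cs.
pose Q (q : cube) : cube := fun g => q (pull (s (A g)) g).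
have Qrem q : in_remainder q -> in_remainder (Q q).
  move=> rq; apply: in_remainderP => [|N].
    have WF := wtail_proper.
    (* [Q q] is the limit in the cube, along the tails of [W], of points of the closure: each
       coordinate becomes constant. *)
    apply: (@closed_cvg _ _ wtail _ (fun a => (fun g => q (pull (s a) g)) : cube)
      (closure (range eval))); first exact: closed_closure.
      by apply: nearW => a; apply: closure_pull; case: rq.
    apply: ptws_cvg => g; apply: cvg_near_cst.
    by exists (A g) => // b /= Ab; exact: AP.
  (* A flow keeps integer parts, so from beyond [N + 2] it lands beyond [N + 1], where [plateau N]
     is 0. *)
  rewrite /Q; apply: (in_remainder_vanish (N := N + 2) rq) => x Nx /=.
  rewrite -[LHS]/(sval (plateau N) (xflow _ x)) plateau0// toH_xflow.
  have := floorD1_gt (toH x); have := floor_le (flow (s (A (plateau N))) (toH x)).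
  by rewrite floor_flow intrD; lra.
have /choice [F FP] := fun p => bcoord_surj (Qrem _ (bcoordP p)).
exists F.
  apply: continuous_bcoord => g.
  have -> : (fun p => bcoord (F p) g) = (fun p => bcoord p (pull (s (A g)) g)).
    by apply/funext => p; rewrite FP.
  exact: bcoord_eval_continuous.
by move=> g; exists (A g) => b Ab p; rewrite FP /Q (AP _ _ Ab)//; exact: bcoordP.
Qed.

(** On the coordinate [g] the composite is the flow for the times [s m - s c] with [c] and [m] late.
    These are eventually within the modulus of [g], so the flow acts as that for time zero. *)
Lemma limit_cancel s F G : coherent s ->
  limit_of s F -> limit_of (fun a n => - s a n) G -> cancel F G.
Proof.
move=> cs lF lG p; apply: bcoord_inj; apply/funext => g.
have [d d0 dP] := pull_modulus g.
(* Halves, because [s c] and [s m] are compared through [s a]. *)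
have [a aP] := cs (fun n => d n / 2) (fun n => divr_gt0 (d0 n) (ltr0Sn _ 1)).
have [b bP] := lG g.
have [c [ac bc]] := wo_sup a b.
(* The stage needed for [F] depends on [g] already pulled by [- s c], so [m] is chosen after [c]. *)
have [e eP] := lF (pull (fun n => - s c n) g).
have [m [cm em]] := wo_sup c e.
rewrite (bP c)// (eP m)// pullD.
rewrite -[RHS](congr1 (bcoord p) (pull0 g)) -(dP (fun n => - s c n + s m n) (fun=> 0)).
- by congr (bcoord p (pull _ g)); apply/funext => n; rewrite /= addr0.
- near=> n.
  have h1 : `|s c n - s a n| <= d n / 2 by near: n; exact: aP.
  have h2 : `|s m n - s a n| <= d n / 2.
    by near: n; apply: aP; exact: (wo_trans le_wo ac cm).
  have -> : - s c n + s m n = (s m n - s a n) - (s c n - s a n) by ring.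
  by rewrite (le_trans (ler_normB _ _))// (splitr (d n)) lerD.
- exact: bcoordP.
Unshelve. all: by end_near. Qed.

Lemma coherentN s : coherent s -> coherent (fun a n => - s a n).
Proof.
move=> cs eta eta0; have [a aP] := cs eta eta0; exists a => b ab.
by apply: filterS (aP b ab) => n; rewrite -opprB normrN opprK addrC.
Qed.

End LimitMaps.

(** * Homeomorphisms from coherent nets, and distinctness of their limits *)

Section Separation.
Variables (R : realType) (W : Type) (le : rel W).
Hypothesis le_wo : well_order le.
Hypothesis W_ne : inhabited W.
Local Notation X := (half_open_interval R).
Local Notation U := (unit_map R X).

Lemma limit_homeomorphism (s : W -> nat -> R) : coherent le s ->
  exists2 F : remainder R X -> remainder R X, homeomorphism F & limit_of le s F.
Proof.
move=> cs; have csN := coherentN cs.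
have [F cF lF] := limit_exists le_wo W_ne cs.
have [G cG lG] := limit_exists le_wo W_ne csN.
exists F => //; exists G; split => //; first exact: (limit_cancel le_wo cs lF lG).
apply: (limit_cancel le_wo csN lG).
by have -> : (fun a n => - - s a n) = s by apply/funext => a; apply/funext => n; rewrite opprK.
Qed.

Section Wave.
Variable C : nat -> R.
Hypothesis C_ge2 : forall n, 2 <= C n.

(* Vanishes at [m + 1/2], equals 1 at [m] and [m + 1], and reaches 1 within distance
   [1 / C m] of [m + 1/2]: a large [C] detects arbitrarily short flow times. *)
Definition wave_piece (m : int) (y : R) : R :=
  Num.min 1 (C `|m|%N * `|y - (m%:~R + 2^-1)|).

Definition wave (y : R) : R := wave_piece (Num.floor y) y.

Lemma wave_piece_itv m y : 0 <= wave_piece m y <= 1.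
Proof.
rewrite /wave_piece le_min ler01 ge_min lexx /= andbT mulr_ge0//.
exact: le_trans (C_ge2 _).
Qed.

Lemma wave_piece_end m y : `|y - (m%:~R + 2^-1)| = 2^-1 -> wave_piece m y = 1.
Proof.
move=> h; apply: min_idPl; rewrite h.
by have := C_ge2 `|m|%N; lra.
Qed.

Lemma wave_piece_continuous m : continuous (wave_piece m).
Proof.
move=> y.
have c1 : z - (m%:~R + 2^-1) @[z --> y] --> y - (m%:~R + 2^-1).
  by apply: cvgB; [exact: cvg_id | exact: cvg_cst].
have c2 : C `|m|%N * `|z - (m%:~R + 2^-1)| @[z --> y] -->
    C `|m|%N * `|y - (m%:~R + 2^-1)|.
  by apply: cvgM; [exact: cvg_cst | exact: (cvg_norm c1)].
by apply: (@continuous_min R R^o (cst 1) (fun z : R => C `|m|%N * `|z - (m%:~R + 2^-1)|));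
  [exact: cst_continuous | exact: c2].
Qed.

Lemma wave_continuous : continuous wave.
Proof.
apply: (@floor_glue_continuous R wave_piece); first exact: wave_piece_continuous.
move=> m; rewrite !wave_piece_end//.
  have -> : m%:~R - (m%:~R + 2^-1) = - 2^-1 :> R by ring.
  by rewrite normrN ger0_norm// invr_ge0.
have -> : m%:~R - ((m - 1)%:~R + 2^-1) = 2^-1 :> R by rewrite intrB; field.
by rewrite ger0_norm// invr_ge0.
Qed.

Lemma wave_subproof : continuous (fun x : X => wave (toH x) : R^o) /\
  forall x : X, 0 <= wave (toH x) <= 1.
Proof.
split=> x; last exact: wave_piece_itv.
exact: cvg_comp_continuous wave_continuous (@toH_continuous R x).
Qed.

Definition wave_map : U := exist _ _ wave_subproof.

Lemma pull_wave (t : nat -> R) x : sval (pull t wave_map) x = wave (flow t (toH x)).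
Proof. by rewrite -toH_xflow. Qed.

Lemma floor_nat_half n : Num.floor (n%:R + 2^-1 : R) = n%:Z.
Proof. by apply: floor_def; rewrite intrD -pmulrn; apply/andP; split; lra. Qed.

Lemma wave_flow_half (t : nat -> R) n :
  wave (flow t (n%:R + 2^-1)) = Num.min 1 (C n * `|phi (t n) 2^-1 - 2^-1|).
Proof.
rewrite /wave floor_flow floor_nat_half /wave_piece /flow floor_nat_half absz_nat -pmulrn.
have -> : n%:R + 2^-1 - n%:R = 2^-1 :> R by ring.
by congr (Num.min _ (_ * `|_|)); ring.
Qed.

End Wave.

(** The midpoints n + 1/2 are moved back for the times [s' d]. From there the flow for [s' d]
    returns to zeros of the wave, while the flow for [s d] overshoots to where it is 1; a cluster
    point of the moved midpoints tells the limits apart. *)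
Lemma limit_neq (s s' : W -> nat -> R) F F' (rho : nat -> R) a :
  (forall n, 0 < rho n) ->
  (forall d, le a d -> \forall n \near \oo, rho n <= s d n - s' d n) ->
  limit_of le s F -> limit_of le s' F' -> F <> F'.
Proof.
move=> rho0 hrho lF lF' FF'.
(* The slope is at least the reciprocal of the displacement of 1/2 in time [rho n], so the wave has
   reached 1 there; the bound 2 makes it 1 at the integers. *)
pose C n : R := Num.max 2 (phi (rho n) 2^-1 - 2^-1)^-1.
have C2 n : 2 <= C n by rewrite le_max lexx.
pose g := wave_map C2.
have [b bP] := lF g; have [b' bP'] := lF' g.
have [c [bc b'c]] := wo_sup le_wo b b'.
have [d [cd ad]] := wo_sup le_wo c a.
pose z n := xflow (fun k => - s' d k) (ofH (n%:R + 2^-1)) : X.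
have toHz n : toH (z n) = flow (fun k => - s' d k) (n%:R + 2^-1).
  by rewrite toH_xflow ofHK//; apply: addr_ge0.
have [q cq qP] := cluster_sequence R z.
have rq : in_remainder q.
  apply: in_remainderP => // N; apply: qP.
  have Nk := archi_boundP (normr_ge0 (N + 1)); set k := Num.bound _ in Nk.
  exists k => // n /= kn; apply: plateau0.
  have zn := (frac_itv (toH (z n))).
  move: zn; rewrite {2}toHz floor_flow floor_nat_half -pmulrn => /andP[zn _].
  have kn' : k%:R <= n%:R :> R by rewrite ler_nat.
  have := ler_norm (N + 1); lra.
have [p pq] := bcoord_surj rq.
have e1 : q (pull (s d) g) = 1.
  apply: qP; near=> n.
  rewrite pull_wave toHz flowD wave_flow_half.
  apply: min_idPl => /=.
  have rn : rho n <= s d n - s' d n by near: n; exact: hrho.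
  have hh : 0 <= (2^-1 : R) <= 1 by lra.
  have h1 := phi_mono hh rn; have h2 := phi_half_gt (rho0 n).
  rewrite ger0_norm; last by lra.
  have : 1 <= C n * (phi (rho n) 2^-1 - 2^-1).
    rewrite -ler_pdivrMr ?subr_gt0// mul1r.
    by rewrite /C le_max lexx orbT.
  move=> h3; apply: le_trans h3 _; rewrite ler_wpM2l ?lerD2r//.
  exact: le_trans (C2 n).
have e0 : q (pull (s' d) g) = 0.
  apply: qP; apply: nearW => n.
  rewrite pull_wave toHz flowD wave_flow_half /=.
  rewrite subrr phi_id; last by lra.
  by rewrite subrr normr0 mulr0; apply: min_idPr.
have := bP d (wo_trans le_wo bc cd) p.
rewrite FF' (bP' d (wo_trans le_wo b'c cd)) pq e1 e0 => /eqP.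
by rewrite eq_sym oner_eq0.
Unshelve. all: by end_near. Qed.

End Separation.

(** * A family of 2^aleph_1 homeomorphisms of the remainder *)

Section HomeomorphismFamily.
Variables (R : realType) (W : Type) (le : rel W).
Hypothesis le_omega1 : is_omega1 le.
Variable c : W -> set nat.
Hypothesis c_surj : forall A, exists a, c a = A.
Local Notation X := (half_open_interval R).

(** Reads a set of naturals as the graph of a function, so that an enumeration of such sets
    enumerates all sequences of naturals. *)
Definition decode (A : set nat) (n : nat) : nat := xget 0%N [set m | A (pickle (n, m))].

Lemma decode_surj (f : nat -> nat) : exists A, decode A = f.
Proof.
exists [set k | exists n, k = pickle (n, f n)]; apply/funext => n; rewrite /decode.
case: xgetP => [m _ [k /(pcan_inj pickleK) [-> ->]] //|/(_ (f n))].
by case; exists n.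
Qed.

Lemma homeomorphism_family : exists F : (W -> bool) -> remainder R X -> remainder R X,
  injective F /\ forall x, homeomorphism (F x).
Proof.
have le_wo : well_order le by case: le_omega1.
have W_ne : inhabited W by have [a _] := c_surj set0; exists.
(* Every positive sequence has one of these below it, which gives coherence. *)
pose eta a n : R := (decode (c a) n).+1%:R^-1.
have eta0 a n : 0 < eta a n by rewrite invr_gt0.
have [s [s1 s2]] := omega1_branches le_omega1 eta0.
have cs x : coherent le (s x).
  move=> e e0.
  have /choice [f fP] : forall n, exists m : nat, m.+1%:R^-1 <= e n.
    move=> n; have [N _ /(_ N)] := near_infty_natSinv_lt (PosNum (e0 n)).
    by move=> h; exists N; apply: ltW; apply: h => /=.
  have [A Af] := decode_surj f; have [a aA] := c_surj A.
  exists a => b ab; apply: filterS (s1 x a b ab) => n h.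
  by apply: le_trans h _; rewrite /eta aA Af.
have /choice [F FP] : forall x, exists F, homeomorphism F /\ limit_of le (s x) F.
  by move=> x; have [F] := limit_homeomorphism le_wo W_ne (cs x); exists F.
exists F; split => [x y xy|x]; last by case: (FP x).
apply: contrapT => nxy.
(* The first stage at which the branches differ; the separation is then applied with the branch that
   is true at [a] first. *)
have [|a xya am] := wo_min le_wo (P := fun a => x a <> y a).
  apply: contrapT => nex; apply: nxy; apply/funext => a.
  by apply: contrapT => na; apply: nex; exists a.
have agree d : wo_lt le d a -> x d = y d.
  by move=> da; apply: contrapT => nd; move/negP: da; apply; exact: am.
have [[_ lx] [_ ly]] := (FP x, FP y).
case xa: (x a); case ya: (y a); rewrite xa ya // in xya.
  have [||rho rho0 hrho] := s2 x y a agree; rewrite ?xa ?ya//.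
  by apply: (limit_neq le_wo rho0 hrho lx ly).
have [||rho rho0 hrho] := s2 y x a (fun d da => esym (agree d da)); rewrite ?xa ?ya//.
by apply: (limit_neq le_wo rho0 hrho ly lx).
Qed.

End HomeomorphismFamily.

(** * Counting continuous functions and trivial maps *)

Section SubtypeTopology.
Variables (T : topologicalType).

Lemma compact_set_type (A : set T) : compact A -> compact [set: A].
Proof.
move=> cA F FF _.
have [|a [Aa cla]] := cA (set_val @ F) _.
  by apply: (@filterE _ F) => x; exact: set_valP.
exists (SigSub (mem_set Aa)); split=> // P Q FP [Q0 [[V oV <-] Va] VQ].
have FP' : F (@set_val T A @^-1` (set_val @` P)).
  by apply: filterS FP => x Px; exists x.
have [_ [[x Px <-] Vx]] := cla (set_val @` P) V FP' (open_nbhs_nbhs (conj oV Va)).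
by exists x; split => //; exact: VQ.
Qed.

Lemma hausdorff_injective (S : topologicalType) (f : S -> T) :
  hausdorff_space T -> continuous f -> injective f -> hausdorff_space S.
Proof.
move=> hT cf fi x y clxy; apply/fi/hT => A B fA fB.
by have [z [Az Bz]] := clxy _ _ (cf x _ fA) (cf y _ fB); exists (f z).
Qed.

End SubtypeTopology.

(** * Countable families of reals coded by sets of naturals *)

Section RealCodes.
Variable R : realType.

Lemma eq_rat_cut (a b : R) : (forall s : rat, ratr s < a <-> ratr s < b) -> a = b.
Proof.
move=> h; apply/eqP; rewrite eq_le; apply/andP; split; rewrite leNgt; apply/negP.
  move=> /rat_in_itvoo [s]; rewrite in_itv /= => /andP[bs sa].
  by have := (h s).1 sa; rewrite ltNge (ltW bs).
move=> /rat_in_itvoo [s]; rewrite in_itv /= => /andP[bs sa].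
by have := (h s).2 sa; rewrite ltNge (ltW bs).
Qed.

Lemma set_nat_code (T : countType) : exists e : set T -> set nat, injective e.
Proof.
exists (fun A => pickle @` A) => A B AB; apply/seteqP.
have pi := pcan_inj (@pickleK T).
by split=> x; rewrite -(image_inj pi) ?AB => h; rewrite -(image_inj pi) -?AB ?AB.
Qed.

(** Each real is replaced by its lower cut of rationals, so a family becomes a subset of a countable
    type. *)
Lemma real_family_code (T : countType) : exists e : (T -> R) -> set nat, injective e.
Proof.
have [c ci] := set_nat_code (T * rat)%type.
exists (fun v => c [set ts | ratr ts.2 < v ts.1]) => v w /ci vw.
apply/funext => t; apply: eq_rat_cut => s.
by have /(congr1 (fun A => A (t, s))) /= := vw; move=> ->.
Qed.

End RealCodes.

Section Continuity.
Variable R : realType.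

Lemma continuous_re_im (K : topologicalType) (f : K -> (complex R)^o) : continuous f ->
  continuous (fun x => complex.Re (f x) : R^o) /\ continuous (fun x => complex.Im (f x) : R^o).
Proof.
move=> cf; split => x; apply/cvgrPdist_lt => e e0;
  have e0' : 0 < e%:C%C by rewrite ltcR.
- move/cvgrPdist_lt: (cf x) => /(_ _ e0'); apply: filterS => y.
  rewrite -ltcR; apply: le_lt_trans; rewrite -raddfB; exact: normc_ge_Re.
- move/cvgrPdist_lt: (cf x) => /(_ _ e0'); apply: filterS => y.
  rewrite -ltcR; apply: le_lt_trans; rewrite -raddfB.
  case: (f x - f y) => a b; rewrite normc_def lecR /= -sqrtr_sqr ler_wsqrtr//.
  by rewrite lerDr sqr_ge0.
Qed.

Lemma continuous_real_complex (K : topologicalType) (f : K -> R^o) : continuous f ->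
  continuous (fun x => (f x)%:C%C : (complex R)^o).
Proof.
move=> cf x; apply/cvgrPdist_lt => e e0.
have : e = (complex.Re e)%:C%C by apply/esym/RRe_real; exact: gtr0_real.
move=> eE; rewrite eE in e0 *; move: e0; rewrite ltcR => e0.
move/cvgrPdist_lt: (cf x) => /(_ _ e0); apply: filterS => y.
by rewrite -raddfB normc_def /= expr0n addr0 sqrtr_sqr ltcR.
Qed.

End Continuity.

(** * Codes for continuous functions and for trivial maps *)

Section RemainderCodes.
Variable R : realType.
Local Notation X := (half_open_interval R).
Local Notation U := (unit_map R X).
Local Notation cube := {ptws U -> R^o}.
Local Notation eval := (@beta_eval R X).
Local Notation bX := (beta R X).
Local Notation Xstar := (remainder R X).

Lemma beta_val_continuous : continuous (fun b : bX => \val b : cube).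
Proof. exact: (@initial_continuous bX cube \val). Qed.

Lemma beta_coord_continuous g : continuous (fun b : bX => (\val b : cube) g : R^o).
Proof.
move=> b; have c2 : (fun f : cube => f g) @ (\val b : cube) --> ((\val b : cube) g : R^o).
  exact: ptws_eval_continuous.
exact: cvg_comp (@beta_val_continuous b) c2.
Qed.

Lemma beta_hausdorff : hausdorff_space bX.
Proof.
exact: hausdorff_injective (@cube_hausdorff R X) beta_val_continuous val_inj.
Qed.

Lemma beta_compact : compact [set: bX].
Proof.
apply: (@compact_set_type cube (closure (range eval))).
apply: (subclosed_compact _ (@cube_compact R X)); first exact: closed_closure.
move=> q cq g; apply: (closure_ptws_eval cq) => [|_ [x _ <-]].
  by apply: (compact_closed (@norm_hausdorff _ _)); exact: segment_compact.
by have [_ /(_ x)] := svalP g; rewrite /= in_itv.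
Qed.

Lemma beta_point_eval x g : (\val (@beta_in R X x) : cube) g = sval g x.
Proof. by []. Qed.

(** The remainder is the common zero set of the extensions of all [plateau N]. *)
Lemma remainder_closed : closed (~` range (@beta_in R X)).
Proof.
have -> : ~` range (@beta_in R X) =
    \bigcap_(N in [set: R]) [set b : bX | (\val b : cube) (plateau N) = 0].
  apply/seteqP; split => b.
    move=> nb N _.
    have rb : in_remainder (\val b : cube).
      split; first exact: set_mem (valP b).
      by move=> x bx; apply: nb; exists x => //; exact/val_inj.
    by apply: (in_remainder_vanish (N := N + 1) rb) => x; exact: plateau0.
  move=> h [x _ xb]; have := h (toH x) I.
  by rewrite /= -xb beta_point_eval plateau1// => /eqP; rewrite oner_eq0.
apply: closed_bigI => N _.
apply: (@preimage_closed _ _ (fun b : bX => (\val b : cube) (plateau N)) [set 0]).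
  by move=> b _; exact: beta_coord_continuous.
exact: closed_eq.
Qed.

Lemma remainder_compact : compact [set: Xstar].
Proof.
apply: (@compact_set_type bX (~` range (@beta_in R X))).
exact: subclosed_compact remainder_closed beta_compact _.
Qed.

Lemma unit_pos_subproof : continuous (fun x : X => pos x : R^o) /\
  forall x : X, 0 <= pos x <= 1.
Proof.
split=> [x|x]; first exact: (@initial_continuous X R^o \val x).
by have /andP[-> /ltW] := pos_itv x.
Qed.

Lemma beta_in_inj : injective (@beta_in R X).
Proof.
move=> x y /(congr1 (fun b : bX => (\val b : cube) (exist _ _ unit_pos_subproof))) xy.
by apply: val_inj; exact: xy.
Qed.

Lemma remainder_near_rat (p : Xstar) (N : R) (B : set bX) : nbhs (\val p : bX) B ->
  exists2 r : rat, N < ratr r & B (@beta_in R X (ofH (ratr r))).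
Proof.
move=> [_ [[V oV <-] Vp] VB].
have [_ [[x Nx <-] Vx]] := in_remainder_away (Num.max N 0) (bcoordP p)
  (open_nbhs_nbhs (conj oV Vp)).
have c1 : eval (ofH y) @[y --> toH x] --> eval (ofH (toH x)).
  have co : ofH y @[y --> toH x] --> ofH (toH x) := @ofH_continuous R (toH x).
  have ce : eval y @[y --> ofH (toH x)] --> eval (ofH (toH x)) := @beta_eval_continuous R X _.
  exact: cvg_comp co ce.
have [e /= e0 he] : \forall y \near toH x, V (eval (ofH y)).
  by apply: c1; rewrite toHK; exact: (open_nbhs_nbhs (conj oV Vx)).
have xe : toH x < toH x + e by rewrite ltrDl.
have [r] := rat_in_itvoo xe; rewrite in_itv /= => /andP[xr re].
exists r; first by move: Nx; rewrite /= gt_max => /andP[/lt_trans Nx _]; exact: Nx.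
apply: VB; apply: he.
by rewrite /= ltr_distlC; apply/andP; split; lra.
Qed.

(** Tietze's theorem in the compact Hausdorff, hence normal, space beta X; compactness of the
    remainder supplies the bound on [f]. *)
Lemma remainder_extension (f : Xstar -> R^o) : continuous f ->
  exists2 F : bX -> R^o, continuous F & forall p, F (\val p) = f p.
Proof.
move=> cf.
have [M [Mreal hM]] := compact_bounded
  (continuous_compact (continuous_subspaceT cf) remainder_compact).
have {}hM p : `|f p| <= `|M| + 1.
  by apply: (hM (`|M| + 1)); [have := ler_norm M; lra | exists p].
pose A : set bX := ~` range (@beta_in R X).
have M0 : 0 < `|M| + 1 by have := normr_ge0 M; lra.
pose f0 := valL_ (0 : R^o) (f : A -> R^o).
have f0E (a : A) : f0 (\val a) = f a.
  exact: (congr1 (fun h => h a) (valLK (0 : R^o) (f : A -> R^o))).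
have cF0 : {within A, continuous (valL_ (0 : R^o) (f : A -> R^o))}.
  exact/subspace_valL_continuousP'.
have bF0 b : A b -> `|f0 b| <= `|M| + 1.
  move=> Ab; have -> : b = \val (SigSub (mem_set Ab) : A) by [].
  by rewrite f0E.
have [F [FE cF _]] := continuous_bounded_extension
  (compact_normal beta_hausdorff beta_compact) remainder_closed M0 cF0 bF0.
exists F => // p; rewrite -FE ?f0E//; exact: valP.
Qed.

Definition rat_point (r : rat) : bX := @beta_in R X (ofH (ratr r)).

(* [v] determines [l], since every neighbourhood of [p] contains rational points
   beyond [N]. *)
Definition rat_limit (p : Xstar) (v : rat -> R) (l : R) : Prop :=
  forall e, 0 < e -> exists N : R, exists2 B : set bX, nbhs (\val p : bX) B &
    forall r, N < ratr r -> B (rat_point r) -> `|l - v r| < e.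

Lemma rat_limit_unique p v l l' : rat_limit p v l -> rat_limit p v l' -> l = l'.
Proof.
move=> h h'; apply/eqP; rewrite -subr_eq0 -normr_le0; apply/ler_addgt0Pr => e e0.
have e2 : 0 < e / 2 by rewrite divr_gt0.
have [N [B nB hB]] := h _ e2; have [N' [B' nB' hB']] := h' _ e2.
have [r] := @remainder_near_rat p (Num.max N N') _ (filterI nB nB').
rewrite gt_max => /andP[Nr Nr'] [Br Br'].
have := hB r Nr Br; have := hB' r Nr' Br'.
rewrite (distrC l') add0r -(subrKA (v r) l) => h1 h2.
by apply: le_trans (ler_normD _ _) _; lra.
Qed.

Lemma rat_limit_continuous (F : bX -> R^o) p : continuous F ->
  rat_limit p (fun r => F (rat_point r)) (F (\val p)).
Proof.
move=> cF e e0; exists 0.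
have /cvgrPdist_lt/(_ e e0) h := cF (\val p).
by exists [set b | `|F (\val p) - F b| < e]; [exact: h | move=> r _; exact].
Qed.

(** Real and imaginary parts extend to beta X, and the values of the extensions at the rational
    points determine them on the remainder. *)
Lemma cfun_code : exists c : cfun R Xstar -> set nat, injective c.
Proof.
have /choice [E EP] : forall f : cfun R Xstar, exists E : (bX -> R^o) * (bX -> R^o),
    [/\ continuous E.1, continuous E.2,
      forall p, E.1 (\val p) = complex.Re (\val f p)
    & forall p, E.2 (\val p) = complex.Im (\val f p)].
  move=> f; have /asboolP/continuous_re_im [cr ci] := valP f.
  have [Er cEr ErE] := remainder_extension cr; have [Ei cEi EiE] := remainder_extension ci.
  by exists (Er, Ei).
have [c ci] := real_family_code R (bool * rat)%type.
exists (fun f => c (fun br => (if br.1 then (E f).1 else (E f).2) (rat_point br.2))).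
move=> f g /ci fg; have [cfr cfi frE fiE] := EP f; have [cgr cgi grE giE] := EP g.
apply: val_inj; apply/funext => p.
have er : complex.Re (\val f p) = complex.Re (\val g p).
  rewrite -frE -grE; apply: (rat_limit_unique (rat_limit_continuous p cfr)).
  suff -> : (fun r => (E f).1 (rat_point r)) = (fun r => (E g).1 (rat_point r)).
    exact: rat_limit_continuous.
  by apply/funext => r; exact: (congr1 (fun v => v (true, r)) fg).
have ei : complex.Im (\val f p) = complex.Im (\val g p).
  rewrite -fiE -giE; apply: (rat_limit_unique (rat_limit_continuous p cfi)).
  suff -> : (fun r => (E f).2 (rat_point r)) = (fun r => (E g).2 (rat_point r)).
    exact: rat_limit_continuous.
  by apply/funext => r; exact: (congr1 (fun v => v (false, r)) fg).
by move: er ei; case: (\val f p) => a b; case: (\val g p) => a' b' /= -> ->.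
Qed.

(** [F] is continuous and extends [f], so the coordinates of [h p] are limits of those of [f] along
    rational points. *)
Lemma trivial_map_limit (h : Xstar -> Xstar) : trivial_map h ->
  exists u : rat -> X, forall p (g : U),
    rat_limit p (fun r => sval g (u r)) (bcoord (h p) g).
Proof.
move=> [K [f [F [cK _ cF Ff Fh]]]].
have [M [Mreal hM]] := compact_bounded
  (continuous_compact (continuous_subspaceT (@toH_continuous R)) cK).
(* [K] is bounded in the half-line coordinate, so [f] is defined at all rational points far out; at
   those in [K], [u] takes a default value. *)
have KM r : `|M| + 1 < ratr r -> (~` K) (ofH (ratr r) : X).
  move=> Mr Kr; have r0 : 0 <= ratr r :> R by have := normr_ge0 M; lra.
  have : `|toH (ofH (ratr r))| <= `|M| + 1.
    by apply: (hM (`|M| + 1)); [have := ler_norm M; lra | exists (ofH (ratr r))].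
  by rewrite ofHK// (ger0_norm r0) leNgt Mr.
pose u r : X := if pselect ((~` K) (ofH (ratr r) : X)) is left k
  then f (SigSub (mem_set k)) else ofH 0.
exists u => p g e e0; exists (`|M| + 1).
have np : (~` (@beta_in R X @` K)) (\val p).
  by move=> [x _ xp]; apply: (set_mem (valP p)); exists x.
pose p' : ~` (@beta_in R X @` K) := SigSub (mem_set np).
have Fp : F p' = \val (h p) by exact: Fh.
have : nbhs (F p') [set b : bX | `|bcoord (h p) g - (\val b : cube) g| < e].
  have /cvgrPdist_lt/(_ e e0) := @beta_coord_continuous g (F p').
  by rewrite Fp.
move=> /cF [_ [[V oV <-] Vp] VB].
exists V; first exact: (open_nbhs_nbhs (conj oV Vp)).
move=> r Mr Vr; have Kr := KM r Mr.
have nr : (~` (@beta_in R X @` K)) (rat_point r).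
  by move=> [x Kx /beta_in_inj xr]; apply: Kr; rewrite -xr.
have := VB (SigSub (mem_set nr)) Vr; rewrite /=.
rewrite /u; case: pselect => // k.
by rewrite (Ff _ (SigSub (mem_set k))).
Qed.

Lemma trivial_map_code : exists c : (Xstar -> Xstar) -> set nat,
  {in [set h | trivial_map h] &, injective c}.
Proof.
have /choice [u uP] : forall h : Xstar -> Xstar, exists u : rat -> X, trivial_map h ->
    forall p (g : U), rat_limit p (fun r => sval g (u r)) (bcoord (h p) g).
  move=> h; have [/trivial_map_limit [u uP]|nt] := pselect (trivial_map h); first by exists u.
  by exists (fun=> ofH 0).
have [c ci] := real_family_code R rat.
exists (fun h => c (fun r => toH (u h r))) => h h' /set_mem th /set_mem th' /ci hh'.
have uu : u h = u h'.
  by apply/funext => r; apply: (can_inj (@toHK R)); exact: (congr1 (fun v => v r) hh').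
apply/funext => p; apply: bcoord_inj; apply/funext => g.
apply: (rat_limit_unique (uP h th p g)); rewrite uu; exact: uP.
Qed.

End RemainderCodes.

Section Composition.
Variables (R : realType) (K : topologicalType).

Lemma composition_automorphism (h : K -> K) : homeomorphism h ->
  exists phi : cfun R K -> cfun R K, cstar_automorphism phi /\
    forall f x, \val (phi f) x = \val f (h x).
Proof.
move=> [g [ch cg hK gK]].
have cc (k : K -> K) (ck : continuous k) (f : cfun R K) :
    (fun x => \val f (k x)) \in @continuous_pred R K.
  apply/asboolP => x; have /asboolP cf := valP f.
  exact: cvg_comp (ck x) (cf (k x)).
exists (fun f => SigSub (cc h ch f)); split => //; split.
- exists (fun f => SigSub (cc g cg f)) => f; apply: val_inj; apply/funext => x /=.
    by rewrite gK.
  by rewrite hK.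
- by move=> a u v; apply: val_inj; apply/funext => x.
- by move=> u v; apply: val_inj; apply/funext => x.
- by apply: val_inj; apply/funext => x.
- by move=> u; apply: val_inj; apply/funext => x.
Qed.

End Composition.

(** * Cardinal comparisons and the counts under CH *)

Section Cardinality.
Local Open Scope card_scope.

Lemma card_le_inj T U (A : set T) (B : set U) (f : T -> U) :
  {in A &, injective f} -> (forall x, A x -> B (f x)) -> A #<= B.
Proof.
move=> fi fB; apply: (@card_le_trans _ _ _ (f @` A)).
  by rewrite (card_le_eql (card_esym (inj_card_eq fi))); exact: card_lexx.
by apply: subset_card_le => _ [x Ax <-]; exact: fB.
Qed.

Lemma set_nat_pair_code : exists e : set nat * set nat -> set nat, injective e.
Proof.
have [c ci] := set_nat_code (bool * nat)%type.
exists (fun AB => c [set bn | (if bn.1 then AB.1 else AB.2) bn.2]) => -[A B] [A' B'] /ci h.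
congr (_, _); apply/funext => n.
  exact: (congr1 (fun S => S (true, n)) h).
exact: (congr1 (fun S => S (false, n)) h).
Qed.

End Cardinality.

Theorem corollary2 (R : realType) (CH : continuum_hypothesis) :
  let Xstar := remainder R (half_open_interval R) in
  [/\ card_exp2_aleph1
        [set phi : cfun R Xstar -> cfun R Xstar | cstar_automorphism phi],
      card_exp2_aleph1 [set h : Xstar -> Xstar | homeomorphism h]
    & exists h : Xstar -> Xstar, homeomorphism h /\ ~ trivial_map h].
Proof.
move=> Xstar.
have [W [le [le_omega1 cW]]] := CH.
have /card_set_bijP [c [_ _ c_surj']] : ([set: W] #= [set: set nat])%card.
  by rewrite card_eq_sym.
have c_surj A : exists a, c a = A by have [a _ aA] := c_surj' A I; exists a.
have /choice [d dK] := c_surj.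
have d_inj : injective d := can_inj dK.
have [F [F_inj F_homeo]] := homeomorphism_family R le_omega1 c_surj.
pose G (S : set W) := F (fun w => `[< S w >]).
have G_inj : injective G.
  move=> S T /F_inj ST; apply/funext => w; apply/propext.
  have st : `[< S w >] = `[< T w >] := congr1 (fun x => x w) ST.
  by split=> /asboolP; [rewrite st | rewrite -st] => /asboolP.
have G_homeo S : homeomorphism (G S) by exact: F_homeo.
have /choice [Phi PhiP] : forall h : Xstar -> Xstar,
    exists phi : cfun R Xstar -> cfun R Xstar, homeomorphism h ->
      cstar_automorphism phi /\ forall f x, \val (phi f) x = \val f (h x).
  move=> h; have [/(composition_automorphism R) [phi phiP]|nh] := pselect (homeomorphism h).
    by exists phi.
  by exists id.
(* The coordinates, seen as complex functions, lie in C(K) and separate points. *)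
have Phi_inj : {in [set h | homeomorphism h] &, injective Phi}.
  move=> h h' /set_mem hh /set_mem hh' ee; apply/funext => p.
  apply: bcoord_inj; apply/funext => g.
  have cg : continuous (fun q : Xstar => bcoord q g : R^o) by exact: bcoord_eval_continuous.
  have gP : (fun q : Xstar => (bcoord q g)%:C%C) \in @continuous_pred R Xstar.
    by apply/asboolP; exact: continuous_real_complex.
  have [_ /(_ (SigSub gP) p) e1] := PhiP h hh.
  have [_ /(_ (SigSub gP) p) e2] := PhiP h' hh'.
  by move: e1; rewrite ee e2 /= => -[].
have homeo_le_auto : ([set h : Xstar -> Xstar | homeomorphism h] #<=
    [set phi : cfun R Xstar -> cfun R Xstar | cstar_automorphism phi])%card.
  by apply: (card_le_inj Phi_inj) => h /PhiP [].
have auto_le : ([set phi : cfun R Xstar -> cfun R Xstar | cstar_automorphism phi]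
    #<= [set: set W])%card.
  have [e e_inj] := cfun_code R.
  have [pair pair_inj] := set_nat_pair_code.
  (* An automorphism is recorded by its graph: [e] codes functions by sets of naturals, and [d],
     obtained from CH, codes those by elements of [W]. *)
  pose graph (phi : cfun R Xstar -> cfun R Xstar) : set W :=
    [set d (pair (e f, e (phi f))) | f in setT].
  apply: (@card_le_inj _ _ _ _ graph) => // phi psi _ _ gr; apply/funext => f.
  have : graph psi (d (pair (e f, e (phi f)))) by rewrite -gr; exists f.
  by move=> [f' _ /d_inj /pair_inj [/e_inj -> /e_inj]].
have le_homeo : ([set: set W] #<= [set h : Xstar -> Xstar | homeomorphism h])%card.
  by apply: (@card_le_inj _ _ _ _ G) => [S T _ _ /G_inj //|S _]; exact: G_homeo.
split.
- exists W, le; split => //; rewrite card_eq_le auto_le /=.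
  exact: card_le_trans le_homeo homeo_le_auto.
- exists W, le; split => //; rewrite card_eq_le le_homeo andbT.
  exact: card_le_trans homeo_le_auto auto_le.
apply: contrapT => no.
have triv S : trivial_map (G S).
  by apply: contrapT => nt; apply: no; exists (G S).
have [e e_inj] := trivial_map_code R.
(* If all [G S] are trivial, their codes inject the subsets of [W] into [W]. *)
have inj : injective (fun S => d (e (G S))).
  move=> S T /d_inj ee; apply: G_inj.
  by apply: e_inj ee; rewrite inE; exact: triv.
(* Cantor's diagonal set for this injection. *)
pose D : set W := [set w | exists2 S, w = d (e (G S)) & ~ S w].
have [Dd|nDd] := pselect (D (d (e (G D)))).
  by have [S /inj <-] := Dd.
by apply: (nDd); exists D.
Qed.
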